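(* For each positive integer $n$, let $H_n$ denote the set of HKZ reduced bases of rank-$n$ lattices and let $\Delta_n=\sup_{B\in H_n}\Delta(B)$. Then for all $n\ge 4$, $$\Delta_n\le \frac{25}{12}\,\gamma_{n-3}^{\,n-3}\prod_{i=4}^n\left(\frac{i}{4}+\frac{29}{24}\right),$$ where $\gamma_{d}$ denotes the Hermite constant in rank $d$.
   Context: For linearly independent vectors $\mathbf{b}_1,\dots,\mathbf{b}_n\in\mathbb{R}^m$, define the Gram–Schmidt data recursively by $\mathbf{b}_1(1)=\mathbf{b}_1$, $\mu_{i,j}=\frac{\langle \mathbf{b}_i,\mathbf{b}_j(j)\rangle}{\|\mathbf{b}_j(j)\|^2}$ for $1\le j<i\le n$, and $\mathbf{b}_i(j)=\mathbf{b}_i-\sum_{k=1}^{j-1}\mu_{i,k}\mathbf{b}_k(k)$ for $1\le j\le i\le n$. The basis $B=\{\mathbf{b}_1,\dots,\mathbf{b}_n\}$ of the lattice $\Lambda(B)=\{\sum_i x_i\mathbf{b}_i: x_i\in\mathbb{Z}\}$ is HKZ reduced if (i) $|\mu_{i,j}|\le 1/2$ for all $1\le j<i\le n$, (ii) $\mathbf{b}_1$ is a shortest nonzero vector of $\Lambda(B)$, and (iii) $\{\mathbf{b}_2(2),\dots,\mathbf{b}_n(2)\}$ is HKZ reduced (recursively). The orthogonality defect is $\Delta(B)=\frac{\prod_{i=1}^n\|\mathbf{b}_i\|^2}{\det(B)^2}$ with $\det(B)^2=\prod_{i=1}^n\|\mathbf{b}_i(i)\|^2$. The Hermite constant $\gamma_d$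 is the supremum, over all rank-$d$ lattice bases $B$, of $\lambda_1(\Lambda(B))^2/\det(B)^{2/d}$, where $\lambda_1$ is the length of a shortest nonzero lattice vector. *)

(* Defs.v *)
From mathcomp Require Import all_boot all_order all_algebra.
From mathcomp Require Import all_classical all_reals all_analysis.
Set Implicit Arguments.
Unset Strict Implicit.
Unset Printing Implicit Defensive.
Import Order.TTheory GRing.Theory Num.Theory.
Local Open Scope classical_set_scope.
Local Open Scope ring_scope.

(* A basis b_1, ..., b_n in R^m is the matrix B whose
   rows are the b_i; vector indices are shifted to start at 0. *)

Section Euclidean.
Variables (R : realType) (m : nat).
Implicit Types u v : 'rV[R]_m.

Definition dot u v : R := \sum_i u 0 i * v 0 i.

(* The library norm `|v| on 'rV[R]_m is the sup norm. *)
Definition enorm v : R := Num.sqrt (dot v v).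

End Euclidean.

Section Basis.
Variables (R : realType) (m : nat).

Definition vec n (B : 'M[R]_(n, m)) (i : nat) : 'rV[R]_m :=
  if insub i is Some k then row k B else 0.

(* gs B j i is b_(i+1)(j+1).  The sum defining b_i(j) is accumulated one term at
   a time, which makes the recursion structural in j; see gsE. *)
Fixpoint gs n (B : 'M[R]_(n, m)) (j i : nat) : 'rV[R]_m :=
  if j is k.+1 then
    gs B k i - (dot (vec B i) (gs B k k) / enorm (gs B k k) ^+ 2) *: gs B k k
  else vec B i.

Definition mu n (B : 'M[R]_(n, m)) (i j : nat) : R :=
  dot (vec B i) (gs B j j) / enorm (gs B j j) ^+ 2.

Lemma gsE n (B : 'M[R]_(n, m)) (i j : nat) :
  gs B j i = vec B i - \sum_(k < j) mu B i k *: gs B k k.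
Proof.
elim: j => [|j IHj]; first by rewrite big_ord0 subr0.
by rewrite big_ord_recr /= IHj opprD addrA.
Qed.

Definition lattice n (B : 'M[R]_(n, m)) : set 'rV[R]_m :=
  [set v | exists x : 'I_n -> int, v = \sum_i (x i)%:~R *: row i B].

Definition shortest_vector (L : set 'rV[R]_m) (v : 'rV[R]_m) : Prop :=
  [/\ L v, v != 0 & forall w, L w -> w != 0 -> enorm v <= enorm w].

(* The default 0 is never reached on the lattice of a nonempty linearly
   independent family, which is discrete. *)
Definition lambda1 (L : set 'rV[R]_m) : R :=
  xget 0 [set enorm v | v in shortest_vector L].

Lemma lambda1E (L : set 'rV[R]_m) (v : 'rV[R]_m) :
  shortest_vector L v -> lambda1 L = enorm v.
Proof.
move=> Lv; apply: xget_unique; first by exists v.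
move=> _ [w [Lw w0 wmin] <-]; case: Lv => Lv v0 vmin.
by apply/eqP; rewrite eq_le wmin ?vmin.
Qed.

(* The family b_2(2), ..., b_n(2). *)
Definition gs_tail n (B : 'M[R]_(n.+1, m)) : 'M[R]_(n, m) :=
  \matrix_(i < n) gs B 1 i.+1.

Fixpoint hkz_conditions n : 'M[R]_(n, m) -> Prop :=
  if n is n'.+1 then fun B =>
    [/\ forall i j : nat, (j < i < n'.+1)%N -> `|mu B i j| <= 1 / 2,
        shortest_vector (lattice B) (vec B 0)
      & hkz_conditions (gs_tail B)]
  else fun=> True.

Definition hkz_reduced n (B : 'M[R]_(n, m)) : Prop :=
  row_free B /\ hkz_conditions B.

Definition latdet n (B : 'M[R]_(n, m)) : R :=
  Num.sqrt (\prod_(i < n) enorm (gs B i i) ^+ 2).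

Definition orth_defect n (B : 'M[R]_(n, m)) : R :=
  (\prod_(i < n) enorm (row i B) ^+ 2) / latdet B ^+ 2.

End Basis.

(* Both suprema range over bases in R^m for every m, and are taken in \bar R so
   that no finiteness is presupposed. *)
Definition Delta (R : realType) (n : nat) : \bar R :=
  ereal_sup [set x | exists m, exists B : 'M[R]_(n, m),
    hkz_reduced B /\ x = (orth_defect B)%:E].

Definition hermite (R : realType) (d : nat) : \bar R :=
  ereal_sup [set x | exists m, exists B : 'M[R]_(d, m),
    row_free B /\
    x = (lambda1 (lattice B) ^+ 2 / latdet B `^ (2 / d%:R))%:E].

(* Main.v *)
(* Write r_i for the squared length of b_i(i).  Size reduction gives
   |b_i|^2 <= r_i + (r_1 + ... + r_(i-1)) / 4.  The first three vectors are
   treated exactly (their defect is at most 25/12), and the Korkine-Zolotarev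
   inequalities r_k <= 4/3 r_(k+1) and r_k <= 3/2 r_(k+2) give
   r_1 + r_2 + r_3 <= (2 + 3/2 + 4/3) r_4 = 4 * 29/24 * r_4.  So, with
   t_i = max(r_4, ..., r_i), |b_i|^2 <= (i/4 + 29/24) t_i for i >= 4.
   To bound the product of the t_i, rescale the Gram-Schmidt axes of the
   lattice of b_4(4), ..., b_n(4) by 1 / sqrt t_i: as t_i is nondecreasing and
   a vector whose last nonzero coordinate is the l-th has squared length at
   least r_j for every j <= l, the new lattice has minimum 1, and its squared
   determinant is the product of the r_i / t_i.  The definition of the Hermite
   constant of rank n - 3 then concludes. *)

Require Import Defs.
From mathcomp Require Import all_boot all_order all_algebra.
From mathcomp Require Import all_classical all_reals all_analysis.
From mathcomp Require Import zify ring lra.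
Import Order.TTheory GRing.Theory Num.Theory.
Local Open Scope ring_scope.

(** * Two inequalities for rank 3 *)

Section RealInequalities.
Context {R : realFieldType}.
Implicit Types b c k l p q u v x y z : R.

(** Chord identity: (q - p) f(b) is (q - b) f(p) + (b - p) f(q) minus k (q - p)(b - p)(q - b), and
    each piece has the right sign. *)
Lemma convex_quadratic_le0 k l c p q b : 0 <= k -> p <= b <= q ->
  k * p ^+ 2 + l * p + c <= 0 -> k * q ^+ 2 + l * q + c <= 0 ->
  k * b ^+ 2 + l * b + c <= 0.
Proof.
move=> k0 /andP[pb bq] fp fq.
have [pq|pq] := eqVneq p q; first by have -> : b = p by lra.
have qp : 0 < q - p by rewrite subr_gt0 lt_neqAle pq (le_trans pb bq).
rewrite -(pmulr_rle0 _ qp).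
have -> : (q - p) * (k * b ^+ 2 + l * b + c) =
  (q - b) * (k * p ^+ 2 + l * p + c) + (b - p) * (k * q ^+ 2 + l * q + c)
  - k * ((q - p) * ((b - p) * (q - b))) by ring.
have h1 : (q - b) * (k * p ^+ 2 + l * p + c) <= 0 by rewrite mulr_ge0_le0 ?subr_ge0.
have h2 : (b - p) * (k * q ^+ 2 + l * q + c) <= 0 by rewrite mulr_ge0_le0 ?subr_ge0.
have h3 : 0 <= k * ((q - p) * ((b - p) * (q - b))).
  by rewrite !mulr_ge0 ?subr_ge0 // ltW // -subr_gt0.
lra.
Qed.

Lemma affine_ge0 p q k l y : p <= y <= q ->
  0 <= k + l * p -> 0 <= k + l * q -> 0 <= k + l * y.
Proof.
move=> /andP[py yq] hp hq; have [l0|l0] := leP 0 l.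
  by apply: le_trans hp _; rewrite lerD2l ler_wpM2l.
by apply: le_trans hq _; rewrite lerD2l ler_wnM2l // ltW.
Qed.

(* In the two lemmas below the squared Gram-Schmidt lengths are 1, b, c and
   x, y, z are the absolute values of mu_21, mu_31, mu_32.  The hypotheses bound
   the lengths of b_2, b_3, b_3 +- b_2 +- b_1 (or b_3 +- b_2) and b_3(2). *)
Lemma korkine_zolotarev_rank3 b c x y z :
  0 <= x <= 1 / 2 -> 0 <= y <= 1 / 2 -> 0 <= z <= 1 / 2 ->
  1 <= x ^+ 2 + b -> 1 <= y ^+ 2 + z ^+ 2 * b + c ->
  1 <= (1 - x - y) ^+ 2 + (1 - z) ^+ 2 * b + c -> b <= z ^+ 2 * b + c -> 2 / 3 <= c.
Proof.
move=> /andP[x0 x1] /andP[y0 y1] /andP[z0 z1] Hx Hy Hxy Hz.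
rewrite leNgt; apply/negP => cl.
have b34 : 3 / 4 <= b by nra.
have bz : (1 - z ^+ 2) * b < 2 / 3 by lra.
have z2 : z ^+ 2 <= 1 / 4 by nra.
have b89 : b < 8 / 9 by nra.
(* With c below 2/3 so little slack is left that all three coefficients are forced into (1/3,
   1/2]. *)
have x13 : 1 / 3 < x by nra.
have y13 : 1 / 3 < y by nra.
have z13 : 1 / 3 < z by nra.
(* On [1/3, 1/2] the chord of the square lies above it. *)
have xl : (7 - 6 * b) / 5 <= x by nra.
have yl : (3 - 6 * (z ^+ 2 * b)) / 5 <= y by nra.
have u0 : 0 <= 1 - x - y by lra.
pose w := (6 * (b * (1 + z ^+ 2)) - 5) / 5.
have uw : 1 - x - y <= w by rewrite /w; lra.
have uw2 : (1 - x - y) ^+ 2 <= w ^+ 2 by rewrite lerXn2r // nnegrE (le_trans u0).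
(* Together with [cl] this contradicts [Hxy]. It is a convex quadratic condition on b, so only the
   two ends of the range of b matter: 3/4, and the bound given by [bz]. *)
suff : w ^+ 2 + (1 - z) ^+ 2 * b <= 1 / 3 by lra.
have D0 : 0 < 1 - z ^+ 2 by lra.
suff : (36 / 25 * (1 + z ^+ 2) ^+ 2) * b ^+ 2
    + ((1 - z) ^+ 2 - 12 / 5 * (1 + z ^+ 2)) * b + 2 / 3 <= 0 by rewrite /w; lra.
apply: (@convex_quadratic_le0 _ _ _ (3 / 4) (2 / (3 * (1 - z ^+ 2)))).
- by rewrite mulr_ge0 ?sqr_ge0 //; lra.
- by rewrite b34 /= ler_pdivlMr; lra.
(* The quadratic vanishes at z = 1/3 at either end of the range, hence the factor 3z - 1 split off
   here and below. *)
- have h : (3 * z - 1) * (3 * z + 1) ^+ 2 * 12 <= 100 * (5 - 3 * z) by nra.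
  have : (3 * z - 1) * ((3 * z - 1) * (3 * z + 1) ^+ 2 * 12)
      <= (3 * z - 1) * (100 * (5 - 3 * z)) by rewrite ler_wpM2l //; lra.
  lra.
have h : 3 * (3 * z - 1) * (3 * z + 1) ^+ 2 <= 25 * (1 - z ^+ 2) * (1 - z).
  have -> : 25 * (1 - z ^+ 2) * (1 - z) = 25 * ((1 - z) ^+ 2 * (1 + z)) by ring.
  have q1 : (3 * z + 1) ^+ 2 <= 25 / 4 by nra.
  have q2 : 3 / 8 <= (1 - z) ^+ 2 * (1 + z) by nra.
  nra.
have {}h : (3 * z - 1) * (3 * (3 * z - 1) * (3 * z + 1) ^+ 2)
    <= (3 * z - 1) * (25 * (1 - z ^+ 2) * (1 - z)) by rewrite ler_wpM2l //; lra.
rewrite -(@ler_pM2l _ (75 * (1 - z ^+ 2) ^+ 2)); last by rewrite mulr_gt0 // exprn_gt0.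
rewrite mulr0 [leLHS](_ : _ = (3 * z - 1) * (3 * (3 * z - 1) * (3 * z + 1) ^+ 2)
  - (3 * z - 1) * (25 * (1 - z ^+ 2) * (1 - z))); first lra.
field; lra.
Qed.

Let gap x b u v :=
  (1 - (1 - x) ^+ 2 + (3 / 2 - 2 * x) * u - (13 / 16 - 9 / 8 * v) * b)
    * (13 * b - 12 * x ^+ 2)
  - 12 * (x ^+ 2 + b) * (u / 2 + (7 / 8 * v - 3 / 16) * b).

Let gap_corner_ge0 x b u v : 2 / 5 <= x -> x <= 1 / 2 -> b <= 1 -> 1 <= x ^+ 2 + b ->
  u = 0 \/ u = 1 / 2 -> v = 3 / 8 \/ v = 1 / 2 -> 0 <= gap x b u v.
Proof.
move=> x0 x1 b1 Hx; rewrite /gap.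
(* Products of slacks of the constraints on x and b, supplied to [nra] as certificate terms for the
   four corners. *)
have h1 : 0 <= (x - 2 / 5) * (1 / 2 - x) by nra.
have h2 : 0 <= (x - 2 / 5) * (1 / 2 - x) * (1 - b) by nra.
have h3 : 0 <= (x - 2 / 5) * (x ^+ 2 + b - 1) by nra.
have h4 : 0 <= (1 / 2 - x) * (x ^+ 2 + b - 1) by nra.
have h5 : 0 <= (1 - b) * (x ^+ 2 + b - 1) by nra.
by move=> [->|->] [->|->]; nra.
Qed.

(** [gap] is affine in each of its last two arguments, so nonnegativity spreads from the corners to
    the edges and then to the rectangle. *)
Let gap_ge0 x b y z : 2 / 5 <= x -> x <= 1 / 2 -> b <= 1 -> 1 <= x ^+ 2 + b ->
  0 <= y <= 1 / 2 -> 3 / 8 <= z <= 1 / 2 -> 0 <= gap x b y z.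
Proof.
move=> x0 x1 b1 Hx y12 z12; have cor := gap_corner_ge0 _ _ _ _ x0 x1 b1 Hx.
have edge v : v = 3 / 8 \/ v = 1 / 2 -> 0 <= gap x b y v.
  move=> hv; have := cor 0 _ (or_introl erefl) hv.
  have := cor (1 / 2) _ (or_intror erefl) hv.
  have := @affine_ge0 _ _ (gap x b 0 v) ((3 / 2 - 2 * x) * (13 * b - 12 * x ^+ 2)
    - 12 * (x ^+ 2 + b) / 2) _ y12.
  by rewrite /gap; lra.
have := edge _ (or_introl erefl); have := edge _ (or_intror erefl).
have := @affine_ge0 _ _ (gap x b y 0) (9 / 8 * b * (13 * b - 12 * x ^+ 2)
  - 12 * (x ^+ 2 + b) * (7 / 8 * b)) _ z12.
by rewrite /gap; lra.
Qed.

Lemma orth_defect_rank3 b c x y z :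
  0 <= x <= 1 / 2 -> 0 <= y <= 1 / 2 -> 0 <= z <= 1 / 2 -> 1 <= x ^+ 2 + b ->
  1 <= (1 - x - y) ^+ 2 + (1 - z) ^+ 2 * b + c -> b <= z ^+ 2 * b + c ->
  12 * ((x ^+ 2 + b) * (y ^+ 2 + z ^+ 2 * b + c)) <= 25 * (b * c).
Proof.
move=> /andP[x0 x1] /andP[y0 y1] /andP[z0 z1] Hx Hxy Hz.
have x2 : x ^+ 2 <= 1 / 4 by nra.
have y2 : y ^+ 2 <= 1 / 4 by nra.
have b34 : 3 / 4 <= b by lra.
have z2 : z ^+ 2 <= 1 / 4 by nra.
have x20 := sqr_ge0 x; have z20 := sqr_ge0 z.
(* Collecting the terms in c leaves [K1] as its coefficient. As [K1] is nonnegative, c may be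
   replaced by any lower bound; the cases below differ in the bound chosen. *)
set K1 := 13 * b - 12 * x ^+ 2; set K2 := 12 * (x ^+ 2 + b).
suff : K2 * (y ^+ 2 + z ^+ 2 * b) <= c * K1 by rewrite /K1 /K2; lra.
have K10 : 0 <= K1 by rewrite /K1; lra.
have K20 : 0 <= K2 by rewrite /K2; lra.
have lower_c l : l <= c -> K2 * (y ^+ 2 + z ^+ 2 * b) <= l * K1 ->
    K2 * (y ^+ 2 + z ^+ 2 * b) <= c * K1.
  by move=> lc /le_trans; apply; rewrite ler_wpM2r.
have small_z t : z ^+ 2 <= t -> K2 * (1 / 4 + t * b) <= (1 - t) * b * K1 ->
    K2 * (y ^+ 2 + z ^+ 2 * b) <= c * K1.
  move=> zt h; apply: (lower_c ((1 - t) * b)); first by nra.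
  by apply: le_trans h; rewrite ler_wpM2l //; nra.
(* The case condition is the premise of [small_z] at t = 1/4 with denominators cleared. *)
have [A|/ltW A] := leP ((16 * b + 4) * x ^+ 2) (9 * b ^+ 2 - 4 * b).
  by apply: (small_z (1 / 4)) => //; rewrite /K1 /K2; nra.
have b1 : b <= 1 by nra.
have [z38|/ltW z38] := leP z (3 / 8).
  apply: (small_z (9 / 64)); first by nra.
  (* This is the premise of [small_z] at t = (3/8)^2, taken at the extreme value x^2 = 1/4. *)
  have : 0 <= 607 * b ^+ 2 - 384 * b - 48 by nra.
  by rewrite /K1 /K2; nra.
have x25 : 2 / 5 <= x.
  have : 4 / 25 <= x ^+ 2.
    rewrite leNgt; apply/negP => h; have b84 : 21 / 25 < b by lra.
    nra.
  nra.
apply: (lower_c (1 - (1 - x - y) ^+ 2 - (1 - z) ^+ 2 * b)); first lra.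
(* The difference of the two sides is concave in y and in z; [gap] is the
   biaffine function below it that agrees with it at the corners. *)
have yy : y * y <= y * (1 / 2) by rewrite ler_wpM2l.
have zz : 0 <= (z - 3 / 8) * (1 / 2 - z) * b by rewrite !mulr_ge0 //; lra.
have q1 : y ^+ 2 + z ^+ 2 * b <= y / 2 + (7 / 8 * z - 3 / 16) * b by lra.
have q2 : 1 - (1 - x) ^+ 2 + (3 / 2 - 2 * x) * y - (13 / 16 - 9 / 8 * z) * b
    <= 1 - (1 - x - y) ^+ 2 - (1 - z) ^+ 2 * b by lra.
have y12 : 0 <= y <= 1 / 2 by rewrite y0.
have z12 : 3 / 8 <= z <= 1 / 2 by rewrite z38.
have := gap_ge0 _ _ _ _ x25 x1 b1 Hx y12 z12; rewrite /gap -/K1 -/K2.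
have := ler_wpM2r K10 q2; have := ler_wpM2l K20 q1; lra.
Qed.

End RealInequalities.

(** * Gram-Schmidt vectors of HKZ reduced bases *)

Section DotProduct.
Context {R : realType} {m : nat}.
Implicit Types u v w : 'rV[R]_m.

Lemma dotC u v : dot u v = dot v u.
Proof. by apply: eq_bigr => i _; rewrite mulrC. Qed.

Lemma dotDl u v w : dot (u + v) w = dot u w + dot v w.
Proof. by rewrite -big_split; apply: eq_bigr => i _; rewrite mxE mulrDl. Qed.

Lemma dotZl a u v : dot (a *: u) v = a * dot u v.
Proof. by rewrite mulr_sumr; apply: eq_bigr => i _; rewrite mxE mulrA. Qed.

Lemma dot0l v : dot 0 v = 0.
Proof. by rewrite -(scale0r 0) dotZl mul0r. Qed.

Lemma dotBl u v w : dot (u - v) w = dot u w - dot v w.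
Proof. by rewrite dotDl -scaleN1r dotZl mulN1r. Qed.

Lemma dot_suml {I} (s : seq I) (P : pred I) (F : I -> 'rV[R]_m) v :
  dot (\sum_(i <- s | P i) F i) v = \sum_(i <- s | P i) dot (F i) v.
Proof.
by elim/big_rec2: _ => [|i x y _ <-]; rewrite ?dot0l ?dotDl.
Qed.

Lemma dot_ge0 v : 0 <= dot v v.
Proof. by apply: sumr_ge0 => i _; rewrite -expr2 sqr_ge0. Qed.

Lemma dot_eq0 v : (dot v v == 0) = (v == 0).
Proof.
apply/idP/eqP => [|->]; last by rewrite dot0l.
rewrite psumr_eq0 => [/allP v0|i _]; last by rewrite -expr2 sqr_ge0.
apply/rowP => i; rewrite mxE; apply/eqP.
by have := v0 i (mem_index_enum i); rewrite mulf_eq0 orbb.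
Qed.

Lemma enorm_sqr v : enorm v ^+ 2 = dot v v.
Proof. by rewrite sqr_sqrtr ?dot_ge0. Qed.

Lemma enorm_le u v : (enorm u <= enorm v) = (dot u u <= dot v v).
Proof. by rewrite ler_sqrt ?dot_ge0. Qed.

Lemma dot_orthogonal_sum {I : eqType} (s : seq I) (c : I -> R) (g : I -> 'rV[R]_m) :
  uniq s -> {in s &, forall i j, i != j -> dot (g i) (g j) = 0} ->
  dot (\sum_(i <- s) c i *: g i) (\sum_(i <- s) c i *: g i) =
  \sum_(i <- s) c i ^+ 2 * dot (g i) (g i).
Proof.
move=> us og; rewrite dot_suml big_seq [RHS]big_seq; apply: eq_bigr => i si.
rewrite dotZl dotC dot_suml (bigD1_seq i) //= big1_seq => [|j /andP[ji sj]].
  by rewrite addr0 dotZl mulrA expr2.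
by rewrite dotZl og ?mulr0.
Qed.

End DotProduct.

Section GramSchmidt.
Context {R : realType} {m : nat}.

Lemma vec_ord {n} (B : 'M[R]_(n, m)) (i : 'I_n) : vec B i = row i B.
Proof. by rewrite /vec valK. Qed.

Lemma vec_default {n} (B : 'M[R]_(n, m)) i : (n <= i)%N -> vec B i = 0.
Proof. by move=> ni; rewrite /vec insubN // -leqNgt. Qed.

Lemma gs_orthogonal_lt {n} (B : 'M[R]_(n, m)) k i j :
  (j < k)%N -> dot (gs B k i) (gs B j j) = 0.
Proof.
elim: k i j => // k IHk i j; rewrite ltnS leq_eqVlt => /predU1P[->|jk] /=; last first.
  by rewrite dotBl dotZl !IHk // mulr0 subrr.
have -> : dot (gs B k i - (dot (vec B i) (gs B k k) / enorm (gs B k k) ^+ 2) *: gs B k k)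
    (gs B k k) = dot (vec B i) (gs B k k)
      - dot (vec B i) (gs B k k) / enorm (gs B k k) ^+ 2 * dot (gs B k k) (gs B k k).
  rewrite dotBl dotZl gsE dotBl dot_suml big1 ?subr0 // => l _.
  by rewrite dotZl dotC IHk ?mulr0.
(* A zero Gram-Schmidt vector makes both terms vanish; otherwise the quotient cancels. *)
rewrite enorm_sqr; have [/eqP|g0] := eqVneq (dot (gs B k k) (gs B k k)) 0.
  by rewrite dot_eq0 => /eqP ->; rewrite dotC !dot0l mulr0 subrr.
by rewrite divfK // subrr.
Qed.

Lemma gs_orthogonal {n} (B : 'M[R]_(n, m)) i j :
  i != j -> dot (gs B i i) (gs B j j) = 0.
Proof.
rewrite neq_ltn => /orP[ij|ji]; last exact: gs_orthogonal_lt.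
by rewrite dotC gs_orthogonal_lt.
Qed.

Lemma gs_vec_comb {n} (B : 'M[R]_(n, m)) k i :
  exists c : nat -> R, gs B k i = vec B i + \sum_(j < k) c j *: vec B j.
Proof.
elim: k i => [|k IHk] i /=; first by exists (fun=> 0); rewrite big_ord0 addr0.
have [c ->] := IHk i; have [d dE] := IHk k; set q := (_ / _).
exists (fun j => if j == k then - q else c j - q * d j).
rewrite dE big_ord_recr /= eqxx -addrA; congr (_ + _).
rewrite scalerDr opprD addrCA scaleNr addrC; congr (_ + _).
rewrite scaler_sumr -sumrB; apply: eq_bigr => j _.
by rewrite ltn_eqF // scalerBl scalerA.
Qed.

(** By [gs_vec_comb] the vector is u B for a row u with entry 1 in position k, and a free B kills no
    nonzero row. *)
Lemma gs_neq0 {n} (B : 'M[R]_(n, m)) k : row_free B -> (k < n)%N -> gs B k k != 0.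
Proof.
move=> freeB kn; have [c ->] := gs_vec_comb B k k.
pose u : 'rV[R]_n := \row_i (if (i < k)%N then c i else (i == k :> nat)%:R).
have -> : vec B k + \sum_(j < k) c j *: vec B j = u *m B.
  rewrite mulmx_sum_row.
  transitivity (\sum_(0 <= i < n) (if (i < k)%N then c i else (i == k :> nat)%:R) *: vec B i).
    rewrite (big_cat_nat (n := k)) //=; last exact: ltnW.
    rewrite [LHS]addrC (@big_ltn _ _ _ k n) // ltnn eqxx scale1r.
    rewrite [X in _ = _ + (_ + X)]big_nat [X in _ = _ + (_ + X)]big1 => [|i].
      by rewrite addr0 big_mkord; congr (_ + _); apply: eq_bigr => i _; rewrite ltn_ord.
    by move=> /andP[ki _]; rewrite ltnNge (ltnW ki) /= gtn_eqF // scale0r.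
  by rewrite big_mkord; apply: eq_bigr => i _; rewrite mxE vec_ord.
rewrite mulmx_free_eq0 //; apply/eqP => /rowP/(_ (Ordinal kn)).
by rewrite !mxE /= ltnn eqxx => /eqP; rewrite oner_eq0.
Qed.

Lemma vec_gs_tail {n} (B : 'M[R]_(n.+1, m)) i : vec (gs_tail B) i = gs B 1 i.+1.
Proof.
have [ni|ni] := leqP n i.
  by rewrite vec_default //= vec_default // dot0l mul0r scale0r subr0.
by rewrite -[i in LHS]/(val (Ordinal ni)) vec_ord; apply/rowP => j; rewrite !mxE.
Qed.

Lemma dot_gs1 {n} (B : 'M[R]_(n, m)) i j :
  dot (gs B 1 i) (gs B j.+1 j.+1) = dot (vec B i) (gs B j.+1 j.+1).
Proof.
rewrite [gs B 1 i]/= dotBl dotZl.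
by rewrite (_ : vec B 0 = gs B 0 0) // (gs_orthogonal B 0 j.+1) // mulr0 subr0.
Qed.

(** Projecting b_1 away first leaves inner products with later Gram-Schmidt vectors unchanged, as
    these are orthogonal to b_1. This translates the recursive HKZ clause back to the original
    basis. *)
Lemma gs_gs_tail {n} (B : 'M[R]_(n.+1, m)) j i :
  gs (gs_tail B) j i = gs B j.+1 i.+1.
Proof.
elim: j i => [|j IHj] i; first exact: vec_gs_tail.
by rewrite [LHS]/= !IHj vec_gs_tail dot_gs1.
Qed.

Definition gs_coef {n} (B : 'M[R]_(n, m)) i j : R :=
  if (j < i)%N then mu B i j else (i == j)%:R.

Lemma gs_expand {n} (B : 'M[R]_(n, m)) k i l : (k <= i < l)%N ->
  gs B k i = \sum_(k <= j < l) gs_coef B i j *: gs B j j.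
Proof.
move=> /andP[ki il].
rewrite (big_cat_nat (n := i)) ?(ltnW il) //= (@big_ltn _ _ _ i l) //.
rewrite [X in _ = _ + (_ + X)]big_nat [X in _ = _ + (_ + X)]big1 ?addr0 => [|j]; last first.
  by move=> /andP[ij _]; rewrite /gs_coef ltnNge (ltnW ij) /= ltn_eqF // scale0r.
rewrite {2}/gs_coef ltnn eqxx scale1r.
rewrite !gsE -!(big_mkord xpredT (fun k => mu B i k *: gs B k k)).
rewrite (big_cat_nat (m := 0) (n := k) (p := i)) //= [RHS]addrC.
rewrite (_ : \sum_(k <= j < i) gs_coef B i j *: _ = \sum_(k <= j < i) mu B i j *: gs B j j).
  by rewrite opprD addrA subrK.
by apply: eq_big_nat => j /andP[_ ji]; rewrite /gs_coef ji.
Qed.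

Lemma dot_gs_comb {n} (B : 'M[R]_(n, m)) k l (x : nat -> R) :
  let v := \sum_(k <= i < l) x i *: gs B k i in
  dot v v = \sum_(k <= j < l) (\sum_(k <= i < l) x i * gs_coef B i j) ^+ 2
                               * dot (gs B j j) (gs B j j).
Proof.
move=> v.
have -> : v = \sum_(k <= j < l) (\sum_(k <= i < l) x i * gs_coef B i j) *: gs B j j.
  transitivity (\sum_(k <= i < l) \sum_(k <= j < l) (x i * gs_coef B i j) *: gs B j j).
    apply: eq_big_nat => i kil; rewrite (gs_expand _ _ _ _ kil) scaler_sumr.
    by apply: eq_bigr => j _; rewrite scalerA.
  by rewrite exchange_big; apply: eq_bigr => j _; rewrite scaler_suml.
rewrite dot_orthogonal_sum ?iota_uniq // => i j _ _; exact: gs_orthogonal.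
Qed.

Lemma hkz_size_reduced {n} (B : 'M[R]_(n, m)) i j :
  hkz_conditions B -> (j < i < n)%N -> `|mu B i j| <= 1 / 2.
Proof. by case: n B => [|n] B; [rewrite ltn0 andbF | case=> + _ _; apply]. Qed.

(** Unrolls the HKZ recursion: level 0 is the shortest vector clause, with coefficients from l on
    set to 0, and a higher level is handed to [gs_tail]. *)
Lemma hkz_min {n} (B : 'M[R]_(n, m)) k l (x : nat -> int) :
  hkz_conditions B -> (k < l <= n)%N ->
  let v := \sum_(k <= i < l) (x i)%:~R *: gs B k i in
  v != 0 -> dot (gs B k k) (gs B k k) <= dot v v.
Proof.
elim: n B k l x => [|n IHn] B k l x; first by move=> _ /andP[/leq_trans h /h].
case=> _ [_ _ minB] hkzB /andP[kl ln].
case: k kl => [|k] kl; last first.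
  case: l kl ln => // l kl ln v.
  have -> : v = \sum_(k <= i < l) (x i.+1)%:~R *: gs (gs_tail B) k i.
    by rewrite /v big_add1 /=; apply: eq_bigr => i _; rewrite gs_gs_tail.
  by rewrite -gs_gs_tail; apply: IHn; rewrite // -ltnS kl.
move=> v v0; rewrite -enorm_le; apply: minB => //.
exists (fun i : 'I_n.+1 => if (i < l)%N then x i else 0).
rewrite (_ : v = \sum_(0 <= i < n.+1) (if (i < l)%N then x i else 0)%:~R *: vec B i).
  by rewrite big_mkord; apply: eq_bigr => i _; rewrite vec_ord.
rewrite (big_cat_nat (n := l)) //= [X in _ = _ + X]big_nat [X in _ = _ + X]big1 ?addr0 => [|i].
  by apply: eq_big_nat => i /andP[_ ->].
by case/andP=> li _; rewrite ltnNge li scale0r.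
Qed.

End GramSchmidt.

(* [r j] is the squared length of b_(j+1)(j+1), and [M] the unitriangular
   matrix of the mu's.  The last clause says that [r k] is the minimum of the
   projected lattice; it only sees the vectors whose last coefficient is
   nonzero, which suffices. *)
Definition hkz_profile {R : realFieldType} n (r : nat -> R) (M : nat -> nat -> R) : Prop :=
  [/\ forall i, (i < n)%N -> 0 < r i,
      forall i, M i i = 1,
      forall i j, (i < j)%N -> M i j = 0,
      forall i j, (j < i < n)%N -> `|M i j| <= 1 / 2
    & forall k l (x : nat -> int), (k <= l < n)%N -> x l != 0 ->
        r k <= \sum_(k <= j < l.+1)
                 (\sum_(k <= i < l.+1) (x i)%:~R * M i j) ^+ 2 * r j].

(* The squared length of b_(i+1). *)
Definition row_norm2 {R : realFieldType} (r : nat -> R) (M : nat -> nat -> R) i : R :=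
  \sum_(0 <= j < i.+1) M i j ^+ 2 * r j.

(** * From HKZ reduced bases to profiles *)

Section HKZProfile.
Context {R : realType} {m n : nat}.
Implicit Types B : 'M[R]_(n, m).

Lemma hkz_reduced_profile B : hkz_reduced B ->
  hkz_profile n (fun j => dot (gs B j j) (gs B j j)) (gs_coef B).
Proof.
move=> [freeB hkzB].
have r_gt0 i : (i < n)%N -> 0 < dot (gs B i i) (gs B i i).
  by move=> i_n; rewrite lt_neqAle dot_ge0 eq_sym dot_eq0 gs_neq0.
split=> [//|i|i j ij|i j ji|k l x /andP[kl ln] xl].
- by rewrite /gs_coef ltnn eqxx.
- by rewrite /gs_coef ltnNge (ltnW ij) /= ltn_eqF.
- by rewrite /gs_coef (andP ji).1 hkz_size_reduced.
rewrite -(dot_gs_comb B k l.+1 (fun i => (x i)%:~R)).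
apply: hkz_min; rewrite ?ltnS ?kl // -dot_eq0 dot_gs_comb.
(* The combination is nonzero because its component along the l-th axis is exactly [x l]. *)
rewrite gt_eqF // big_nat_recr //=; apply: ltr_wpDl.
  by apply: sumr_ge0 => j _; rewrite mulr_ge0 ?sqr_ge0 ?dot_ge0.
rewrite big_nat_recr //= big_nat big1 => [|i /andP[_ il]]; last first.
  by rewrite /gs_coef ltnNge (ltnW il) /= ltn_eqF // mulr0.
by rewrite add0r /gs_coef ltnn eqxx mulr1 pmulr_rgt0 ?r_gt0 // exprn_even_gt0 //= intr_eq0.
Qed.

Lemma vec_norm_profile B i :
  dot (vec B i) (vec B i) =
  row_norm2 (fun j => dot (gs B j j) (gs B j j)) (gs_coef B) i.
Proof.
rewrite /row_norm2 (_ : vec B i = gs B 0 i) // (gs_expand B 0 i i.+1) ?ltnSn //.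
rewrite dot_orthogonal_sum ?iota_uniq // => j k _ _; exact: gs_orthogonal.
Qed.

End HKZProfile.

(** Take e = 1 or -1 with sign opposite to z. If e x and y have opposite signs, f = 0 works since
    both are at most 1/2 in absolute value; otherwise f = 1 or -1 against their common sign. *)
Lemma nearest_signs {R : realFieldType} (x y z : R) :
  `|x| <= 1 / 2 -> `|y| <= 1 / 2 ->
  exists f e : int, [/\ (f%:~R + e%:~R * x + y) ^+ 2 <= (1 - `|x| - `|y|) ^+ 2
                    & (e%:~R + z) ^+ 2 = (1 - `|z|) ^+ 2].
Proof.
wlog z0 : x z / 0 <= z => [wl hx hy|].
  have [/wl|/ltW z0] := leP 0 z; first exact.
  have := wl (- x) (- z); rewrite oppr_ge0 !normrN => /(_ z0 hx hy) [f [e [h1 h2]]].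
  exists f, (- e); rewrite mulrNz mulNr -mulrN; split=> //.
  by rewrite -h2 -sqrrN; congr (_ ^+ 2); ring.
move=> hx hy.
have [f hf] : exists f : int, (f%:~R - x + y) ^+ 2 <= (1 - `|x| - `|y|) ^+ 2.
  have sq (u v : R) : - v <= u <= v -> u ^+ 2 <= v ^+ 2.
    rewrite -ler_norml => uv; rewrite -(real_normK (num_real u)).
    by rewrite lerXn2r ?nnegrE // (le_trans _ uv).
  case: (ger0P x) hx => x0 hx; case: (ger0P y) hy => y0 hy.
  - by exists 0; apply: sq; lra.
  - by exists 1; apply: sq; lra.
  - by exists (-1); apply: sq; lra.
  - by exists 0; apply: sq; lra.
exists f, (-1); rewrite mulN1r (ger0_norm z0); split=> //.
by rewrite -sqrrN; congr (_ ^+ 2); ring.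
Qed.

(** * Inequalities between the Gram-Schmidt lengths of a profile *)

Section Profile.
Context {R : realFieldType} {n : nat} {r : nat -> R} {M : nat -> nat -> R}.
Hypothesis rM : hkz_profile n r M.

Lemma profile_rank2 k (f e : int) : (k.+1 < n)%N -> e != 0 ->
  r k <= (f%:~R + e%:~R * M k.+1 k) ^+ 2 * r k + e%:~R ^+ 2 * r k.+1.
Proof.
case: rM => _ M1 M0 _ H kn e0.
have := H k k.+1 (fun i => if (i == k)%N then f else e).
rewrite leqnSn kn gtn_eqF // => /(_ isT e0).
rewrite !big_nat_recr ?leqnSn //= !big_geq // !add0r eqxx gtn_eqF //.
by rewrite !M1 !(M0 k) // !mulr1 mulr0 add0r.
Qed.

Lemma profile_rank3 k (f e g : int) : (k.+2 < n)%N -> g != 0 ->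
  r k <= (f%:~R + e%:~R * M k.+1 k + g%:~R * M k.+2 k) ^+ 2 * r k
         + (e%:~R + g%:~R * M k.+2 k.+1) ^+ 2 * r k.+1 + g%:~R ^+ 2 * r k.+2.
Proof.
case: rM => _ M1 M0 _ H kn g0.
have := H k k.+2 (fun i => if (i == k)%N then f else if (i == k.+1)%N then e else g).
have k2 : (k.+2 == k)%N = false by lia.
rewrite kn (_ : (k <= k.+2)%N = true) ?k2 ?(gtn_eqF (ltnSn k.+1)); last by lia.
move=> /(_ isT g0).
rewrite !big_nat_recr //=; try lia.
rewrite !big_geq // !add0r !eqxx !k2 !(gtn_eqF (ltnSn _)).
by rewrite !M1 !(M0 k) ?(M0 k.+1 k.+2) // !mulr1 !mulr0 !add0r.
Qed.

Lemma profile_gt0 i : (i < n)%N -> 0 < r i.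
Proof. by case: rM => + _ _ _ _; apply. Qed.

Lemma profile_coef_le i j : (j < i < n)%N -> `|M i j| <= 1 / 2.
Proof. by case: rM => _ _ _ + _; apply. Qed.

Lemma profile_coef_sqr_le i j : (j < i < n)%N -> M i j ^+ 2 <= 1 / 4.
Proof.
move=> /profile_coef_le h; rewrite -(real_normK (num_real _)).
by have := normr_ge0 (M i j); nra.
Qed.

Lemma profile_succ k : (k.+1 < n)%N -> r k <= M k.+1 k ^+ 2 * r k + r k.+1.
Proof.
move=> kn; have := profile_rank2 k 0 1 kn isT.
by rewrite !mulr1z mulr0z add0r !mul1r expr1n mul1r.
Qed.

(** Division by [r k] gives the normalisation of the rank 3 inequalities. The third bound tests
    minimality on the combination found by [nearest_signs], the last one on level k + 1. *)
Lemma profile_block k : (k.+2 < n)%N ->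
  let x := `|M k.+1 k| in let y := `|M k.+2 k| in let z := `|M k.+2 k.+1| in
  let b := r k.+1 / r k in let c := r k.+2 / r k in
  [/\ 1 <= x ^+ 2 + b, 1 <= y ^+ 2 + z ^+ 2 * b + c,
      1 <= (1 - x - y) ^+ 2 + (1 - z) ^+ 2 * b + c & b <= z ^+ 2 * b + c].
Proof.
move=> kn x y z b c; have r0 : 0 < r k by apply: profile_gt0; lia.
have bE : b * r k = r k.+1 by rewrite divfK ?gt_eqF.
have cE : c * r k = r k.+2 by rewrite divfK ?gt_eqF.
have k1n : (k.+1 < n)%N by lia.
have xx := real_normK (num_real (M k.+1 k)).
have yy := real_normK (num_real (M k.+2 k)).
have zz := real_normK (num_real (M k.+2 k.+1)).
split; rewrite -(ler_pM2r r0).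
- by have := profile_succ _ k1n; rewrite /x xx; lra.
- have := profile_rank3 k 0 0 1 kn isT.
  by rewrite /y /z yy zz -bE -cE; lra.
- have [f [e [h1 h2]]] : exists f e : int, [/\ (f%:~R + e%:~R * M k.+1 k + M k.+2 k) ^+ 2
      <= (1 - x - y) ^+ 2 & (e%:~R + M k.+2 k.+1) ^+ 2 = (1 - z) ^+ 2].
    by apply: nearest_signs; apply: profile_coef_le; lia.
  have := profile_rank3 k f e 1 kn isT.
  rewrite !mulr1z !mul1r h2 expr1n mul1r -bE -cE => h3.
  rewrite -(ler_pM2r r0) in h1; lra.
- by have := profile_succ _ kn; rewrite /z zz -bE -cE; lra.
Qed.

Lemma profile_succ_le k : (k.+1 < n)%N -> r k <= 4 / 3 * r k.+1.
Proof.
move=> kn; have := profile_succ k kn.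
have r0 : 0 < r k by apply: profile_gt0; lia.
have : M k.+1 k ^+ 2 <= 1 / 4 by apply: profile_coef_sqr_le; lia.
nra.
Qed.

Lemma profile_succ2_le k : (k.+2 < n)%N -> r k <= 3 / 2 * r k.+2.
Proof.
move=> kn; have [h1 h2 h3 h4] := profile_block k kn.
have r0 : 0 < r k by apply: profile_gt0; lia.
have c0 i j : (j < i < n)%N -> 0 <= `|M i j| <= 1 / 2.
  by move=> /profile_coef_le ->; rewrite normr_ge0.
have /(ler_wpM2r (ltW r0)) : 2 / 3 <= r k.+2 / r k.
  by apply: (korkine_zolotarev_rank3 _ _ _ _ _ _ _ _ h1 h2 h3 h4); apply: c0; lia.
by rewrite divfK ?gt_eqF //; lra.
Qed.

Lemma profile_head_defect : (2 < n)%N ->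
  row_norm2 r M 0 * row_norm2 r M 1 * row_norm2 r M 2 <= 25 / 12 * (r 0 * r 1 * r 2).
Proof.
move=> n2; have [h1 _ h3 h4] := profile_block 0 n2.
have r0 : 0 < r 0 by apply: profile_gt0; lia.
have c0 i j : (j < i < n)%N -> 0 <= `|M i j| <= 1 / 2.
  by move=> /profile_coef_le ->; rewrite normr_ge0.
have : 12 * ((`|M 1 0| ^+ 2 + r 1 / r 0)
    * (`|M 2 0| ^+ 2 + `|M 2 1| ^+ 2 * (r 1 / r 0) + r 2 / r 0)) <= 25 * (r 1 / r 0 * (r 2 / r 0)).
  by apply: (orth_defect_rank3 _ _ _ _ _ _ _ _ h1 h3 h4); apply: c0; lia.
rewrite !real_normK ?num_real // => h.
have [_ M1 _ _ _] := rM.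
rewrite /row_norm2 !big_nat_recr //= !big_geq // !add0r !M1 !expr1n !mul1r.
(* Multiplying by the cube of [r 0] undoes the normalisation, one power for each of the three
   rows. *)
have := ler_wpM2l (exprn_ge0 3 (ltW r0)) h.
set L := (X in X <= _ -> _); set L' := (X in _ <= X -> _).
have -> : L = 12 * (r 0 * (M 1 0 ^+ 2 * r 0 + r 1) * (M 2 0 ^+ 2 * r 0 + M 2 1 ^+ 2 * r 1 + r 2)).
  by rewrite /L; field; rewrite gt_eqF.
have -> : L' = 25 * (r 0 * r 1 * r 2) by rewrite /L'; field; rewrite gt_eqF.
lra.
Qed.

Lemma profile_row_le i t : (3 <= i < n)%N -> (forall j, (3 <= j <= i)%N -> r j <= t) ->
  row_norm2 r M i <= (i.+1%:R / 4 + 29 / 24) * t.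
Proof.
move=> /andP[i3 i_n] rt.
have r_ge0 j : (j < n)%N -> 0 <= r j by move=> jn; rewrite ltW ?profile_gt0.
have [_ M1 _ _ _] := rM.
rewrite /row_norm2 big_nat_recr //= M1 expr1n mul1r (big_cat_nat (n := 3)) //=.
have hd : \sum_(0 <= j < 3) M i j ^+ 2 * r j <= 29 / 24 * t.
  apply: (@le_trans _ _ (\sum_(0 <= j < 3) 1 / 4 * r j)).
    apply: ler_sum_nat => j j3; apply: ler_wpM2r; first by apply: r_ge0; lia.
    by apply: profile_coef_sqr_le; lia.
  rewrite !big_nat_recr //= big_geq //.
  have := rt 3 ltac:(lia); have := profile_succ_le 2 ltac:(lia).
  have := profile_succ2_le 1 ltac:(lia); have := profile_succ2_le 0 ltac:(lia).
  lra.
(* These i - 3 terms give (i - 3) / 4, and the diagonal term adds 1: in total (i + 1) / 4. *)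
have md : \sum_(3 <= j < i) M i j ^+ 2 * r j <= (i - 3)%:R / 4 * t.
  apply: (@le_trans _ _ (\sum_(3 <= j < i) 1 / 4 * t)).
    apply: ler_sum_nat => j j3; apply: ler_pM; rewrite ?sqr_ge0 //.
    - by apply: r_ge0; lia.
    - by apply: profile_coef_sqr_le; lia.
    - by apply: rt; lia.
  by rewrite sumr_const_nat -mulr_natl; lra.
have := rt i ltac:(lia); move: md hd; rewrite natrB // -natr1; lra.
Qed.

(** Passage to the lattice projected orthogonally to the first k vectors: the minimality clause
    already ranges over every starting level. *)
Lemma profile_shift k :
  hkz_profile (n - k) (fun j => r (j + k)) (fun i j => M (i + k) (j + k)).
Proof.
case: rM => r0 M1 M0 Mh H; split=> [i i_n|i|i j ij|i j ji|p l x pl xl].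
- by apply: r0; lia.
- exact: M1.
- by apply: M0; lia.
- by apply: Mh; lia.
have := H (p + k)%N (l + k)%N (fun i => x (i - k)%N) ltac:(lia).
rewrite addnK => /(_ xl); rewrite -addSn.
rewrite big_addn addnK => /le_trans; apply; rewrite le_eqVlt; apply/predU1P; left.
apply: eq_bigr => j _; congr (_ ^+ 2 * _).
by rewrite big_addn addnK; apply: eq_bigr => i _; rewrite addnK.
Qed.

End Profile.

(** * Running maxima of the squared lengths *)

Fixpoint running_max {R : realFieldType} (s : nat -> R) i : R :=
  if i is j.+1 then Num.max (running_max s j) (s j.+1) else s 0.

Section RunningMax.
Context {R : realFieldType} (s : nat -> R).

Lemma running_max_ge i j : (j <= i)%N -> s j <= running_max s i.
Proof.
elim: i => [|i IHi]; first by rewrite leqn0 => /eqP ->.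
rewrite leq_eqVlt => /predU1P[->|/IHi ji]; rewrite /= le_max ?lexx ?orbT //.
by rewrite ji.
Qed.

Lemma running_max_attained i : exists2 j, (j <= i)%N & running_max s i = s j.
Proof.
elim: i => [|i [j ji IHi]]; first by exists 0%N.
rewrite /= maxEle; case: ifP => _; first by exists i.+1.
by exists j; [apply: leqW|].
Qed.

Lemma running_max_homo : {homo running_max s : i j / (i <= j)%N >-> i <= j}.
Proof. by apply: homo_leq => // [y x z|i]; [apply: le_trans | rewrite /= le_max lexx]. Qed.

End RunningMax.

(** * The rescaled lattice *)

(** For a lower triangular matrix the k-th Gram-Schmidt vector is a multiple of the k-th unit
    vector, so each step just erases one more column. *)
Lemma gs_trig {R : realType} {d} (B : 'M[R]_d) (k : nat) (i : 'I_d) :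
  is_trig_mx B -> (forall j, B j j != 0) -> (k <= i)%N ->
  gs B k i = \row_j (if (j < k)%N then 0 else B i j).
Proof.
move=> /is_trig_mxP trigB diagB; elim: k i => [|k IHk] i ki.
  by rewrite /= vec_ord; apply/rowP => j; rewrite !mxE.
pose k' := Ordinal (ltn_trans ki (ltn_ord i)).
have gE : gs B k k = B k' k' *: delta_mx 0 k'.
  rewrite (IHk k') //; apply/rowP => j; rewrite !mxE eqxx /=.
  case: (ltngtP j k) => [jk|kj|jk].
  - by rewrite -val_eqE /= ltn_eqF // mulr0.
  - by rewrite -val_eqE /= gtn_eqF // mulr0 trigB.
  - by have -> : j = k' by [exact: val_inj]; rewrite eqxx mulr1.
have dotk (u : 'rV_d) : dot u (delta_mx 0 k') = u 0 k'.
  rewrite /dot (bigD1 k') //= !mxE !eqxx mulr1 big1 ?addr0 // => j jk.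
  by rewrite mxE (negPf jk) andbF mulr0.
rewrite /= gE enorm_sqr (IHk i (ltnW ki)) vec_ord ![dot _ (_ *: _)]dotC !dotZl.
rewrite ![dot (delta_mx _ _) _]dotC dotZl !dotk.
apply/rowP => j; rewrite !mxE !eqxx /= mulr1 ltnS.
have Bk := diagB k'.
case: (ltngtP j k) => [jk|kj|jk].
- by rewrite -val_eqE /= ltn_eqF // !mulr0 subrr.
- by rewrite -val_eqE /= gtn_eqF // !mulr0 subr0.
- have -> : j = k' by [exact: val_inj].
  by rewrite eqxx mulr1; field.
Qed.

(* Row [i] of the basis, in the orthonormal frame of its Gram-Schmidt vectors,
   with the [j]-th axis rescaled by the square root of the running maximum, so
   that the first vector has length 1 and remains a shortest one. *)
Definition rescaled_basis {R : realType} d (r : nat -> R) (M : nat -> nat -> R) : 'M[R]_d :=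
  \matrix_(i, j) (M i j * Num.sqrt (r j / running_max r j)).

Section Rescaled.
Context {R : realType} {d : nat} {r : nat -> R} {M : nat -> nat -> R}.
Hypothesis rM : hkz_profile d.+1 r M.
Let B := rescaled_basis d.+1 r M.

Lemma running_max_gt0 i : (i < d.+1)%N -> 0 < running_max r i.
Proof. by move=> id; apply: lt_le_trans (running_max_ge r i i _); rewrite ?(profile_gt0 rM). Qed.

Let ratio_gt0 i : (i < d.+1)%N -> 0 < r i / running_max r i.
Proof. by move=> id; rewrite divr_gt0 ?running_max_gt0 ?(profile_gt0 rM). Qed.

Lemma rescaled_trig : is_trig_mx B.
Proof. by have [_ _ M0 _ _] := rM; apply/is_trig_mxP => i j ij; rewrite mxE M0 // mul0r. Qed.

Lemma rescaled_diag j : B j j = Num.sqrt (r j / running_max r j).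
Proof. by have [_ M1 _ _ _] := rM; rewrite mxE M1 mul1r. Qed.

Lemma rescaled_diag_neq0 j : B j j != 0.
Proof. by rewrite rescaled_diag sqrtr_eq0 -ltNge ratio_gt0. Qed.

Lemma rescaled_free : row_free B.
Proof.
rewrite row_free_unit unitmxE (det_trig rescaled_trig) unitfE.
by apply/prodf_neq0 => i _; apply: rescaled_diag_neq0.
Qed.

Lemma rescaled_latdet : latdet B ^+ 2 = \prod_(i < d.+1) (r i / running_max r i).
Proof.
rewrite sqr_sqrtr; last by apply: prodr_ge0 => i _; rewrite sqr_ge0.
apply: eq_bigr => i _; rewrite enorm_sqr (gs_trig _ _ _ rescaled_trig rescaled_diag_neq0) //.
rewrite /dot (bigD1 i) //= big1 => [|j ji]; rewrite !mxE.
  rewrite ltnn; have := rescaled_diag i; rewrite mxE => ->.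
  by rewrite addr0 -expr2 sqr_sqrtr // ltW ?ratio_gt0.
case: ltngtP ji => [||/val_inj ->]; rewrite ?mul0r ?eqxx // => ij _.
by have [_ _ M0 _ _] := rM; rewrite M0 // !mul0r.
Qed.

(** Let l be the last nonzero coordinate and p <= l an index with r_p = t_l. Minimality at level p
    bounds the unscaled squares on the axes p to l from below by t_l, while rescaling divides them
    by t_j <= t_l. *)
Lemma rescaled_norm_ge1 w : lattice B w -> w != 0 -> 1 <= dot w w.
Proof.
have [_ M1 M0 _ H] := rM.
case=> x -> {w} w0; pose y i := x (inord i).
set w := \sum_i _ in w0 *.
have [l xl xmax] : exists2 l : 'I_d.+1, x l != 0 & forall i : 'I_d.+1, (l < i)%N -> x i = 0.
  have [i0 xi0] : exists i, x i != 0.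
    apply/existsP; apply: contraNT w0 => /existsPn x0; rewrite /w big1 // => i _.
    by have := x0 i; rewrite negbK => /eqP ->; rewrite scale0r.
  have [l xl lmax] := arg_maxnP (P := fun i => x i != 0) (fun i : 'I_d.+1 => i : nat) xi0.
  exists l => // i li; apply/eqP; apply: contraTT li => /lmax.
  by rewrite -leqNgt.
have wE (j : 'I_d.+1) (p : nat) : (p <= j)%N -> w 0 j =
    (\sum_(p <= i < l.+1) (y i)%:~R * M i j) * Num.sqrt (r j / running_max r j).
  move=> pj; rewrite /w summxE mulr_suml.
  pose F i := (y i)%:~R * M i j * Num.sqrt (r j / running_max r j).
  transitivity (\sum_(0 <= i < d.+1) F i).
    rewrite big_mkord; apply: eq_bigr => i _.
    by rewrite !mxE /F /y inord_val mulrA.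
  rewrite (big_cat_nat (n := l.+1)) //= [X in _ + X]big_nat [X in _ + X]big1 ?addr0; last first.
    by move=> i /andP[li id]; rewrite /F /y xmax ?mul0r // inordK.
  have [pl|lp] := leqP p l.+1.
    rewrite (big_cat_nat (n := p)) //= big_nat big1 ?add0r // => i /andP[_ ip].
    by rewrite /F M0 ?mulr0 ?mul0r // (leq_trans ip pj).
  rewrite [RHS]big_geq 1?ltnW // big_nat big1 // => i /andP[_ il].
  by rewrite /F M0 ?mulr0 ?mul0r // (leq_trans _ pj) // (leq_trans il) // ltnW.
have [p pl pmax] := running_max_attained r l.
have t0 := running_max_gt0 l (ltn_ord l).
have hp := H p l y; rewrite pl ltn_ord /y inord_val -/y in hp.
have {}hp := hp isT xl.
pose G j := (\sum_(p <= i < l.+1) (y i)%:~R * M i j) ^+ 2 * r j.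
rewrite -[1](divff (lt0r_neq0 t0)) {1}pmax.
apply: (@le_trans _ _ ((\sum_(p <= j < l.+1) G j) / running_max r l)).
  by rewrite ler_pM2r ?invr_gt0.
pose D j := w 0 (inord j) ^+ 2.
have -> : dot w w = \sum_(0 <= j < d.+1) D j.
  by rewrite big_mkord; apply: eq_bigr => j _; rewrite /D inord_val expr2.
(* The squares on the axes before p and after l are dropped. *)
rewrite [leRHS](big_cat_nat (n := p)) //=; last by rewrite ltnW // (leq_ltn_trans pl).
rewrite [X in _ <= _ + X](big_cat_nat (n := l.+1)) //=; last exact: leqW.
rewrite mulr_suml addrCA ler_wpDr //.
  by rewrite addr_ge0 // sumr_ge0 // => j _; rewrite sqr_ge0.
apply: ler_sum_nat => j /andP[pj jl].
have jd : (j < d.+1)%N by rewrite (leq_trans jl).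
rewrite /D (wE _ p) inordK // exprMn (sqr_sqrtr (ltW (ratio_gt0 j jd))) /G -mulrA.
rewrite ler_wpM2l ?sqr_ge0 // ler_pM2l ?(profile_gt0 rM) //.
by rewrite lef_pV2 ?posrE ?running_max_gt0 // running_max_homo.
Qed.

Lemma rescaled_lambda1 : lambda1 (lattice B) = 1.
Proof.
have [_ M1 M0 _ _] := rM.
have r0 : 0 < r 0 by apply: (profile_gt0 rM).
have nB : dot (row 0 B) (row 0 B) = 1.
  rewrite /dot big_ord_recl big1 => [|j _]; rewrite !mxE; last by rewrite M0 // !mul0r.
  by rewrite M1 !mul1r addr0 divff ?gt_eqF // sqrtr1 mulr1.
have eB : enorm (row 0 B) = 1 by rewrite /enorm nB sqrtr1.
rewrite -eB; apply: lambda1E; split=> [||w Lw w0].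
- exists (fun i => (i == 0)%:Z); rewrite (bigD1 0) //= mulr1z scale1r big1 ?addr0 // => i i0.
  by rewrite (negPf i0) scale0r.
- by rewrite -dot_eq0 nB oner_eq0.
- by rewrite enorm_le nB rescaled_norm_ge1.
Qed.

End Rescaled.

(** * The Hermite constant and the final bound *)

Lemma lee_expe {R : realDomainType} (a b : \bar R) k :
  (0 <= a -> a <= b -> a ^+ k <= b ^+ k)%E.
Proof.
move=> a0 ab; elim: k => [|k IHk]; first by rewrite !expe0.
by rewrite !expeS lee_pmul // expe_ge0.
Qed.

(** The rescaled lattice has minimum 1, so the (d+1)-th power of its Hermite ratio is the inverse
    squared determinant, which is the product on the left. *)
Lemma hermite_ge_profile {R : realType} d (r : nat -> R) M : hkz_profile d.+1 r M ->
  ((\prod_(0 <= i < d.+1) (running_max r i / r i))%:E <= hermite R d.+1 ^+ d.+1)%E.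
Proof.
move=> rM; pose B := rescaled_basis d.+1 r M.
pose h := lambda1 (lattice B) ^+ 2 / latdet B `^ (2 / d.+1%:R).
have hE : h ^+ d.+1 = \prod_(0 <= i < d.+1) (running_max r i / r i).
  rewrite /h (rescaled_lambda1 rM) expr1n mul1r exprVn -powR_mulrn ?powR_ge0 //.
  rewrite -powRrM divfK ?pnatr_eq0 // powR_mulrn ?sqrtr_ge0 // (rescaled_latdet rM).
  by rewrite -prodfV big_mkord; apply: eq_bigr => i _; rewrite invf_div.
rewrite -hE EFin_expe lee_expe //.
  by rewrite lee_fin divr_ge0 ?sqr_ge0 ?powR_ge0.
by apply: ereal_sup_ubound; exists d.+1, B; split=> //; apply: rescaled_free rM.
Qed.

Lemma orth_defect_profile {R : realType} {m n} (B : 'M[R]_(n, m)) :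
  let r j := dot (gs B j j) (gs B j j) in
  orth_defect B = \prod_(0 <= i < n) (row_norm2 r (gs_coef B) i / r i).
Proof.
move=> r; rewrite /orth_defect /latdet sqr_sqrtr; last first.
  by apply: prodr_ge0 => i _; rewrite sqr_ge0.
rewrite prodf_div !big_mkord; congr (_ / _); apply: eq_bigr => i _; rewrite enorm_sqr //.
by rewrite -vec_ord vec_norm_profile.
Qed.

Lemma profile_defect_le {R : realFieldType} d (r : nat -> R) M : hkz_profile d.+4 r M ->
  \prod_(0 <= i < d.+4) (row_norm2 r M i / r i) <=
  25 / 12 * \prod_(0 <= i < d.+1) (running_max (fun j => r (j + 3)) i / r (i + 3))
          * \prod_(4 <= i < d.+4.+1) (i%:R / 4 + 29 / 24).
Proof.
move=> rM; pose s j := r (j + 3).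
have r_gt0 := profile_gt0 rM.
have N_ge0 i : (i < d.+4)%N -> 0 <= row_norm2 r M i.
  move=> id; rewrite /row_norm2 big_nat sumr_ge0 // => j /andP[_ ji].
  by rewrite mulr_ge0 ?sqr_ge0 ?ltW ?r_gt0 // (leq_trans ji).
rewrite (big_cat_nat (n := 3)) //= -mulrA ler_pM //.
- by rewrite big_nat prodr_ge0 // => i i3; rewrite divr_ge0 ?N_ge0 ?ltW ?r_gt0 //; lia.
- by rewrite big_nat prodr_ge0 // => i i3; rewrite divr_ge0 ?N_ge0 ?ltW ?r_gt0 //; lia.
- rewrite prodf_div ler_pdivrMr; last by rewrite big_nat prodr_gt0 // => i i3; apply: r_gt0; lia.
  by rewrite !big_nat_recr //= !big_geq // !mul1r; apply: (profile_head_defect rM).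
have shift3 F : \prod_(3 <= i < d.+4) F i = \prod_(0 <= i < d.+1) F (i + 3) :> R.
  by rewrite -[X in index_iota X]add0n big_addn.
(* Rows are counted from 0 and the factors of the bound from 1: row i + 3 meets the factor of index
   i + 4. *)
rewrite [X in _ <= _ * X]big_add1 /= !shift3.
rewrite -big_split /= big_nat [leRHS]big_nat; apply: ler_prod => i id.
have ri : 0 < s i by apply: r_gt0; lia.
rewrite divr_ge0 ?N_ge0 ?(ltW ri) //=; last by lia.
rewrite mulrAC ler_pM2r ?invr_gt0 // mulrC.
rewrite -(addSn i 3); apply: (profile_row_le rM); first by lia.
move=> j /andP[j3 ji]; rewrite -(subnK j3).
by apply: (running_max_ge s); lia.
Qed.

Theorem theorem3 (R : realType) (n : nat) (hn : (4 <= n)%N) :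
  (Delta R n <= (25 / 12)%:E * hermite R (n - 3) ^+ (n - 3)
                * (\prod_(4 <= i < n.+1) (i%:R / 4 + 29 / 24))%:E)%E.
Proof.
case: n hn => [|[|[|[|d]]]] // _.
apply: ge_ereal_sup => _ [m [B [hB ->]]].
have rM := hkz_reduced_profile B hB.
have := profile_defect_le _ _ _ rM; rewrite -orth_defect_profile -lee_fin => /le_trans; apply.
have c_ge0 : 0 <= \prod_(4 <= i < d.+4.+1) (i%:R / 4 + 29 / 24 : R).
  by apply: prodr_ge0 => i _; have := ler0n R i; lra.
rewrite 2!EFinM; apply: lee_wpmul2r; first by rewrite lee_fin.
apply: lee_wpmul2l; first by rewrite lee_fin; lra.
(* Shifting by 3 leaves a profile of rank d + 1 = n - 3. *)
exact: hermite_ge_profile (profile_shift rM 3).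
Qed.
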